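(* Let $(X,d)$ be a compact metric space which is weakly homogeneous. Then there is a constant $C\in(0,\infty)$ such that for every uniform measure $\mu$ on $X$ $$h_-(\mu;r)\ \ge\ \frac{C}{N(r)},\qquad 0<r<\infty .$$
   Context: $D$ is the diameter of $X$, and $B(x,r)=\{y\in X: d(x,y)\le r\}$ is the closed ball. For $T\subset X$ and $\epsilon>0$, $N(T,d,\epsilon)$ is the minimal number of closed balls $B(x_j,\epsilon)$ (with $x_j\in X$) covering $T$; $N(\epsilon)=N(X,d,\epsilon)$. For $r,\epsilon>0$ put $N_-(r,\epsilon)=\inf_{x\in X}N(B(x,r),d,\epsilon)$. For a Borel probability measure $\mu$ on $X$, $h_-(\mu;r)=\inf_{x\in X}\mu(B(x,r))$. Weak homogeneity: $(X,d)$ is weakly homogeneous if there is a constant $C_-$, $0<C_-\le 1$, such that for all $\epsilon,r$ with $0<\epsilon\le r$ $$\frac{N_-(r,\epsilon)}{N(\epsilon)}\ge\frac{C_-}{N(r)} .$$ Uniform measure: for $\epsilon\in(0,D)$ an optimal $\epsilon$-net is a set $S(\epsilon)=\{x_1(\epsilon),\dots,x_{N(\epsilon)}(\epsilon)\}\subset X$ of exactly $N(\epsilon)$ points such that the balls $B(x_k(\epsilon),\epsilon)$ cover $X$; given a choice of such nets let $\nu_\epsilon(A)=\operatorname{card}\{k:x_k(\epsilon)\in A\}/N(\epsilon)$ for Borel $A$. A uniform measure on $X$ is any Borel probability measure which is the weak limit of a sequence $\nu_{\epsilon_m}$ with $\epsilon_m\to0+$. *)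

(* Defs.v *)
From HB Require Import structures.
From mathcomp Require Import all_boot all_order all_algebra.
From mathcomp Require Import all_classical all_reals all_analysis.

Set Implicit Arguments.
Unset Strict Implicit.
Unset Printing Implicit Defensive.

Import Order.TTheory GRing.Theory Num.Theory.
Import numFieldNormedType.Exports.

Local Open Scope classical_set_scope.
Local Open Scope ring_scope.

(* Nonempty metric spaces: [measurableType] requires a distinguished point.
   The empty space carries no probability measure. *)
#[short(type="pMetricType")]
HB.structure Definition PointedMetric (K : numDomainType) :=
  { M of Metric K M & Pointed M }.

Section covering.
Context {R : realType} {X : pMetricType R}.
Implicit Types (x : X) (r eps : R) (T : set X).

(* The library's [closed_ball] is the closure of the open ball, which can be
   smaller than the set below. *)
Definition cball x r : set X := [set y | mdist x y <= r].

Definition ball_cover (n : nat) T eps (c : 'I_n -> X) : Prop :=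
  T `<=` \bigcup_k cball (c k) eps.

Definition coverable T eps (n : nat) : Prop :=
  exists c : 'I_n -> X, ball_cover T eps c.

(* The minimal number of closed eps-balls covering T; by convention 0 when
   there is no finite cover, which cannot happen if X is compact and eps > 0. *)
Definition covering_number T eps : nat :=
  xget 0%N [set n | coverable T eps n /\
                    forall m, coverable T eps m -> (n <= m)%N].

Definition covnum eps : nat := covering_number [set: X] eps.

Definition lower_covnum r eps : R :=
  inf [set (covering_number (cball x r) eps)%:R | x in [set: X]].

Definition diam : R := sup [set mdist x y | x in [set: X] & y in [set: X]].

End covering.

Arguments covnum {R} X eps.
Arguments lower_covnum {R} X r eps.
Arguments diam {R} X.

Definition weakly_homogeneous (R : realType) (X : pMetricType R) : Prop :=
  exists C : R, [/\ 0 < C, C <= 1 &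
    forall eps r : R, 0 < eps -> eps <= r ->
      C / (covnum X r)%:R <= lower_covnum X r eps / (covnum X eps)%:R].

Notation borel X := (g_sigma_algebraType (@open X)).

Section net_measure.
Context {R : realType} {X : pMetricType R}.

Definition optimal_net (eps : R) (c : 'I_(covnum X eps) -> X) : Prop :=
  injective c /\ ball_cover [set: X] eps c.

Definition net_measure (n : nat) (c : 'I_n -> X) (A : set (borel X)) : \bar R :=
  (#|[pred k | c k \in A]|%:R / n%:R)%:E.

Section is_measure.
Variables (n : nat) (c : 'I_n -> X).

Let c' (k : nat) : borel X := oapp c point (insub k).

Let net_measureE A :
  net_measure c A =
  mscale (n%:R^-1)%:nng (msum (fun k => \d_(c' k)) n) A.
Proof.
rewrite /net_measure /mscale /msum /=.
transitivity (n%:R^-1%:E * \sum_(k < n) (c k \in A)%:R%:E : \bar R)%E.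
  rewrite sumEFin -EFinM mulrC -natr_sum; congr (_ * _%:R)%:E.
  rewrite -sum1_card big_mkcond/=; apply: eq_bigr => k _.
  by rewrite inE; case: (_ \in _).
congr (_ * _)%E; apply: eq_bigr => k _.
by rewrite -[RHS]/(\d_(c' k) A) diracE /c' valK.
Qed.

Let net_measure0 : net_measure c set0 = 0%E.
Proof. by rewrite net_measureE measure0. Qed.

Let net_measure_ge0 A : (0 <= net_measure c A)%E.
Proof. by rewrite net_measureE. Qed.

Let net_measure_sigma_additive : semi_sigma_additive (net_measure c).
Proof.
have -> : net_measure c =
    mscale (n%:R^-1)%:nng (msum (fun k => \d_(c' k)) n).
  by apply/funext => A; exact: net_measureE.
exact: measure_semi_sigma_additive.
Qed.

HB.instance Definition _ := isMeasure.Build _ (borel X) R (net_measure c)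
  net_measure0 net_measure_ge0 net_measure_sigma_additive.

End is_measure.
End net_measure.

Definition weak_cvg (R : realType) (X : pMetricType R)
    (nu : nat -> {measure set (borel X) -> \bar R})
    (mu : {measure set (borel X) -> \bar R}) : Prop :=
  forall f : X -> R, continuous f -> [bounded f x | x in [set: X]] ->
    (\int[nu m]_x (f x)%:E)%E @[m --> \oo] --> (\int[mu]_x (f x)%:E)%E.

Definition uniform_measure (R : realType) (X : pMetricType R)
    (mu : probability (borel X) R) : Prop :=
  exists2 S : forall eps : R, 'I_(covnum X eps) -> X,
    (forall eps, 0 < eps -> eps < diam X -> optimal_net (S eps)) &
    exists eps_ : nat -> R,
      [/\ forall m, 0 < eps_ m < diam X,
          eps_ m @[m --> \oo] --> 0 &
          weak_cvg (fun m => net_measure (S (eps_ m))) mu].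

Definition lower_ball_measure (R : realType) (X : pMetricType R)
    (mu : probability (borel X) R) (r : R) : \bar R :=
  ereal_inf [set mu (cball x r) | x in [set: X]].

(* Main.v *)
Require Import Defs.
From mathcomp Require Import all_boot all_order all_algebra.
From mathcomp Require Import all_classical all_reals all_analysis.
From mathcomp Require Import measurable_realfun.

(** Fix a centre [x] and a radius [r], and let [c] be an optimal [eps]-net with
    [eps <= r].  The balls of the net that meet [B(x, r)] have their centres in
    [B(x, r + eps)] and already cover [B(x, r)].  Hence [B(x, r + eps)] contains
    at least [N(B(x, r), eps) >= N_-(r, eps)] net points, and dividing by
    [N(eps)] weak homogeneity gives [nu_eps(B(x, r + eps)) >= C_- / N(r)]
    ([net_measure_cball_ge]).

    The radius is enlarged here, rather than shrunk to [r - eps], because [N]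
    may jump at [r] from the left: a lower bound by [C_- / N(r')] with [r' < r]
    would not be enough.  An enlarged ball costs nothing in the limit.  For
    [r < s < t] the bound holds for [nu_eps(B(x, s))] as soon as [eps] is
    small; testing weak convergence against a continuous function that is [1] on
    [B(x, s)] and [0] off [B(x, t)] transfers it to [mu(B(x, t))]
    ([weak_cvg_separator_ge]); and [B(x, r)] is the decreasing intersection of
    the balls [B(x, t)] with [t > r], so continuity from above gives it for
    [mu(B(x, r))] ([cball_measure_right_ge]).  The constant of weak homogeneity
    itself serves as [C]. *)

Set Implicit Arguments.
Unset Strict Implicit.
Unset Printing Implicit Defensive.

Import Order.TTheory GRing.Theory Num.Theory.
Import numFieldNormedType.Exports.

Local Open Scope classical_set_scope.
Local Open Scope ring_scope.

Section covering_numbers.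
Context {R : realType} {X : pMetricType R}.
Implicit Types (x : X) (r s t eps : R) (T : set X).

Lemma covering_number_le T eps n :
  coverable T eps n -> (covering_number T eps <= n)%N.
Proof.
move=> Tn.
have exn : exists n, `[< coverable T eps n >] by exists n; apply/asboolP.
have [m /asboolP Tm mP] := ex_minnP exn.
have /(xgetPex 0%N)[_] : exists n, coverable T eps n /\
    forall m, coverable T eps m -> (n <= m)%N.
  by exists m; split => // k /asboolP; exact: mP.
exact.
Qed.

Lemma lower_covnum_le x r eps :
  lower_covnum X r eps <= (covering_number (cball x r) eps)%:R.
Proof. by apply: ge_inf; [exists 0 => _ [y _ <-]; exact: ler0n|exists x]. Qed.

(** A net ball that meets [B(x, r)] has its centre in [B(x, r + eps)], so the
    net points of the larger ball suffice to cover the smaller one. *)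
Lemma covering_number_le_card n (c : 'I_n -> X) x r eps :
  ball_cover [set: X] eps c ->
  (covering_number (cball x r) eps <= #|[pred k | c k \in cball x (r + eps)]|)%N.
Proof.
move=> cX; apply: covering_number_le.
exists (fun i => c (enum_val i)) => y xyr.
have [k _ cky] := cX y I.
have kP : k \in [pred k | c k \in cball x (r + eps)].
  rewrite !inE /cball/=.
  by rewrite (le_trans (metric_triangle _ y _))// lerD// metric_sym.
by exists (enum_rank_in kP k) => //; rewrite enum_rankK_in.
Qed.

Lemma net_measure_cball_ge (C : R) x r eps (c : 'I_(covnum X eps) -> X) :
  C / (covnum X r)%:R <= lower_covnum X r eps / (covnum X eps)%:R ->
  ball_cover [set: X] eps c ->
  ((C / (covnum X r)%:R)%:E <= net_measure c (cball x (r + eps)))%E.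
Proof.
move=> Cr cX; rewrite lee_fin (le_trans Cr)// ler_wpM2r// ?invr_ge0//.
by rewrite (le_trans (lower_covnum_le x r eps))// ler_nat covering_number_le_card.
Qed.

End covering_numbers.

Section balls.
Context {R : realType} {X : pMetricType R}.
Implicit Types (x : X) (r s t : R).

Lemma sub_cball x r s : r <= s -> cball x r `<=` cball x s.
Proof. by move=> rs y /le_trans; exact. Qed.

Lemma open_setC_cball x r : open (~` cball x r).
Proof.
rewrite openE => y /negP; rewrite -ltNge => rxy.
apply/nbhs_ballP; exists (mdist x y - r) => /=; first by rewrite subr_gt0.
move=> z; rewrite ballEmdist /= => yz xzr.
have := metric_triangle x z y; rewrite leNgt => /negP; apply.
by rewrite (metric_sym z) -ltrBrDl (lt_le_trans yz)// lerB.
Qed.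

Lemma measurable_cball x r : measurable (cball x r : set (borel X)).
Proof.
rewrite -[cball x r]setCK; apply: measurableC.
by apply: sub_sigma_algebra; exact: open_setC_cball.
Qed.

Lemma cball_separator x s t : s < t ->
  uniform_separator (~` cball x t) (cball x s).
Proof.
move=> st; apply: uniform_separatorW.
exists [set yz : X * X | ball yz.1 (t - s) yz.2].
  by rewrite -entourage_ballE; exists (t - s) => //=; rewrite subr_gt0.
rewrite -subset0 => -[y z] [[/= yt zs]]; rewrite ballEmdist/= => yz.
apply: yt; rewrite /cball/= (le_trans (metric_triangle _ z _))//.
by rewrite -(subrKC s t) lerD// metric_sym ltW.
Qed.

Lemma measurable_continuous (f : X -> R) : continuous f ->
  measurable_fun [set: borel X] (f : borel X -> R).
Proof.
move=> /continuousP cf.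
apply: (measurability _ (RGenOpens.measurableE R)) => _ [_ [a [b ->]] <-].
rewrite setTI; apply: sub_sigma_algebra; apply: cf; exact: interval_open.
Qed.

(** One half of the portmanteau theorem, with a continuous function separating
    [B] from the complement of [C] in place of closedness of [B]. *)
Lemma weak_cvg_separator_ge (nu : nat -> {measure set (borel X) -> \bar R})
    (mu : {measure set (borel X) -> \bar R}) (B C : set (borel X))
    (a : \bar R) :
  weak_cvg nu mu -> measurable B -> measurable C ->
  uniform_separator (~` C : set X) B ->
  (\forall m \near \oo, (a <= nu m B)%E) -> (a <= mu C)%E.
Proof.
move=> numu mB mC /(@uniform_separatorP X R)[f [cf f01 f0 f1]] anu.
have {}f01 y : 0 <= f y <= 1 by have /= := f01 (f y) (ex_intro2 _ _ y I erefl).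
have mf : measurable_fun [set: borel X] (fun y : borel X => (f y)%:E).
  by apply/measurable_EFinP; exact: measurable_continuous.
have m1 (A : set (borel X)) : measurable A ->
    measurable_fun [set: borel X] (fun y => (\1_A y : R)%:E).
  by move=> mA; apply/measurable_EFinP; exact: measurable_indic.
have fbd : [bounded f x | x in [set: X]].
  exists 1; split=> // M M1 y _ /=; have /andP[? ?] := f01 y.
  by rewrite ger0_norm// (le_trans _ (ltW M1)).
have fC : (\int[mu]_y (f y)%:E <= mu C)%E.
  rewrite -[leRHS](congr1 mu (setIT C)) -integral_indic//.
  apply: ge0_le_integral => // [y _||y _].
  - by rewrite lee_fin; have /andP[] := f01 y.
  - exact: m1.
  - rewrite lee_fin indicE; have [yC|yC] := boolP (y \in C).
      by have /andP[] := f01 y.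
    by rewrite (f0 (f y))//; exists y => // /mem_set; exact/negP.
apply: le_trans fC; apply: cvge_ge (numu f cf fbd).
apply: filterS anu => m /le_trans; apply.
rewrite -[leLHS](congr1 (nu m) (setIT B)) -integral_indic//.
apply: ge0_le_integral => // [|y _]; first exact: m1.
rewrite lee_fin indicE; have [yB|_] := boolP (y \in B).
  by rewrite (f1 (f y))//; exists y => //; exact/set_mem.
by have /andP[] := f01 y.
Qed.

(** [B(x, r)] is the intersection of the balls [B(x, r + 1/(n+1))], so this is
    continuity from above of the finite measure [mu]; it relies on the balls
    being closed. *)
Lemma cball_measure_right_ge (mu : probability (borel X) R) x r (a : \bar R) :
  (forall t, r < t -> (a <= mu (cball x t))%E) -> (a <= mu (cball x r))%E.
Proof.
move=> amu; pose F n : set (borel X) := cball x (r + n.+1%:R^-1).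
have capF : \bigcap_n F n = cball x r.
  apply/seteqP; split => [y Fy|y xyr n _]; last first.
    by apply: sub_cball xyr; rewrite lerDl.
  apply/ler_addgt0Pr => e e0.
  have [n _ /(_ n (leqnn n)) ne] := near_infty_natSinv_lt (PosNum e0).
  by rewrite (le_trans (Fy n I))// lerD2l ltW.
rewrite -capF; apply: cvge_ge (nonincreasing_cvg_mu _ _ _ _).
- by apply: nearW => n /=; apply: amu; rewrite ltrDl.
- by rewrite (le_lt_trans (probability_le1 _ _)) ?ltry//; exact: measurable_cball.
- by move=> n; exact: measurable_cball.
- by rewrite capF; exact: measurable_cball.
- move=> n m nm; apply/subsetPset/sub_cball.
  by rewrite lerD2l lef_pV2 ?posrE// ler_nat.
Qed.

End balls.

Theorem theorem2p1 (R : realType) (X : pMetricType R)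
    (cptX : compact [set: X]) (whX : weakly_homogeneous X) :
  exists2 C : R, 0 < C &
    forall mu : probability (borel X) R, uniform_measure mu ->
    forall r : R, 0 < r ->
      ((C / (covnum X r)%:R)%:E <= lower_ball_measure mu r)%E.
Proof.
have [C [C0 _ CX]] := whX; exists C => // mu [S netS [e [e_gt0 e0 numu]]] r r0.
apply/ereal_infP => _ [x _ <-].
apply: cball_measure_right_ge => t rt; pose s := (r + t) / 2.
have [rs st] : r < s /\ s < t by rewrite /s midf_lt// midf_lt.
apply: (weak_cvg_separator_ge numu (@measurable_cball _ _ x s)) => //.
- exact: measurable_cball.
- exact: cball_separator.
have d0 : 0 < Num.min r (s - r) by rewrite lt_min r0 subr_gt0.
have : \forall m \near \oo, `|e m| < Num.min r (s - r).
  exact: (@cvgr0_norm_lt _ R).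
apply: filterS => m; have /andP[em0 emD] := e_gt0 m.
rewrite gtr0_norm// lt_min => /andP[emr ems].
have [_ cover] := netS _ em0 emD.
apply: le_trans (net_measure_cball_ge x (CX _ _ em0 (ltW emr)) cover) _.
apply: le_measure; rewrite ?inE; try exact: measurable_cball.
by apply: sub_cball; rewrite -lerBrDl ltW.
Qed.
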